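(* Let $\mathcal{M}^{II}_m$ be a timelike second kind meridian surface of hyperbolic type in $\mathbb{R}^4_1$, parametrized by $z(u,v)=f(u)\,l(v)+g(u)\,e_1$, $u\in I$, $v\in J$. Then $\mathcal{M}^{II}_m$ is flat (its Gauss curvature vanishes identically) if and only if the meridian curve $m:u\mapsto(f(u),g(u))$ is given by $$f(u)=a\,u+b,\qquad g(u)=\pm\sqrt{a^2-1}\;u+c,$$ where $a,b,c$ are constants.
   Context: $\mathbb{R}^4_1$ is the Minkowski 4-space with metric $\langle\cdot,\cdot\rangle = dx_1^2+dx_2^2+dx_3^2-dx_4^2$ and standard orthonormal frame $e_1,e_2,e_3,e_4$ ($e_4$ timelike). $\mathbb{H}^2(-1)=\{V\in\mathrm{span}\{e_2,e_3,e_4\}:\langle V,V\rangle=-1,\ \text{the } e_4\text{-coordinate of }V\text{ is positive}\}$. A timelike second kind meridian surface of hyperbolic type is the surface $z(u,v)=f(u)l(v)+g(u)e_1$, where $I,J\subset\mathbb{R}$ are intervals, $f,g:I\to\mathbb{R}$ are smooth with $f>0$, and $l:J\to\mathbb{H}^2(-1)$ is a smooth curve with $\langle l',l'\rangle=1$ (prime $=d/dv$). The meridian curve is normalized by $\dot f^2-\dot g^2=1$ (dot $=d/du$), so the induced metric is $-du^2+f(u)^2dv^2$, which is Lorentzian. The Gauss curvature is that of this metric, $K=\dfrac{\langle\sigma(X,X),\sigma(Y,Y)\rangle-\langle\sigma(X,Y),\sigma(X,Y)\rangle}{\langle X,X\rangle\langle Y,Y\rangle-\langle X,Y\rangle^2}$,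 with $\sigma$ the second fundamental form. *)

(* Defs.v *)
From HB Require Import structures.
From mathcomp Require Import all_boot all_order all_algebra.
From mathcomp Require Import all_classical all_reals all_analysis.
Set Implicit Arguments.
Unset Strict Implicit.
Unset Printing Implicit Defensive.
Import Order.TTheory GRing.Theory Num.Theory.
Import numFieldNormedType.Exports.
Local Open Scope ring_scope.
Local Open Scope classical_set_scope.

Section Minkowski.
Variable R : realType.

(* The vectors e_1, e_2, e_3, e_4 are [frame 0], [frame 1], [frame 2],
   [frame 3]: coordinates are numbered from 0, the last one being timelike. *)
Definition frame (k : 'I_4) : 'rV[R]_4 := delta_mx 0 k.

Definition minkowski_mx : 'M[R]_4 :=
  diag_mx (\row_(k < 4) if k == ord_max then -1 else 1).

Definition mdot (X Y : 'rV[R]_4) : R := (X *m minkowski_mx *m Y^T) 0 0.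

Definition hyperbolic_plane : set 'rV[R]_4 :=
  [set V | [/\ (V <= frame 1 + frame 2 + frame 3)%MS,
               mdot V V = -1
             & 0 < V 0 3]].

End Minkowski.

Section Surfaces.
Variable R : realType.
Implicit Type z : R -> R -> 'rV[R]_4.

Definition partial_u z : R -> R -> 'rV[R]_4 :=
  fun u v => derive1 (z ^~ v) u.
Definition partial_v z : R -> R -> 'rV[R]_4 :=
  fun u v => derive1 (z u) v.

(* Subspaces of R^4_1 are given as row spaces. *)
Definition tangent_plane z (u v : R) : 'M[R]_4 :=
  (<<partial_u z u v>> + <<partial_v z u v>>)%MS.

(* The Minkowski-orthogonal complement of the tangent plane: the rows X with
   X *m minkowski_mx *m T^T = 0. *)
Definition normal_plane z (u v : R) : 'M[R]_4 :=
  kermx (minkowski_mx R *m (tangent_plane z u v)^T).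

(* Projection onto the normal plane along the tangent plane; meaningful when
   the induced metric is nondegenerate at (u, v), so that the two planes are
   supplementary. *)
Definition normal_part z (u v : R) (W : 'rV[R]_4) : 'rV[R]_4 :=
  W *m proj_mx (normal_plane z u v) (tangent_plane z u v).

(* The second fundamental form on the coordinate frame z_u, z_v: the ambient
   connection being flat, sigma(z_u, z_v) is the normal part of z_uv, etc. *)
Definition sigma_uu z (u v : R) :=
  normal_part z u v (partial_u (partial_u z) u v).
Definition sigma_uv z (u v : R) :=
  normal_part z u v (partial_u (partial_v z) u v).
Definition sigma_vv z (u v : R) :=
  normal_part z u v (partial_v (partial_v z) u v).

(* The quotient does not depend on the basis X, Y of the tangent plane; it is
   taken here at X = z_u, Y = z_v. *)
Definition gauss_curvature z (u v : R) : R :=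
  (mdot (sigma_uu z u v) (sigma_vv z u v)
     - mdot (sigma_uv z u v) (sigma_uv z u v))
  / (mdot (partial_u z u v) (partial_u z u v)
       * mdot (partial_v z u v) (partial_v z u v)
     - mdot (partial_u z u v) (partial_v z u v) ^+ 2).

Definition flat_on (I J : interval R) z : Prop :=
  forall u v, u \in I -> v \in J -> gauss_curvature z u v = 0.

End Surfaces.

Section Meridian.
Variable R : realType.

Definition nondegenerate (I : interval R) : Prop :=
  exists x y, [/\ x \in I, y \in I & x < y].

(* Intervals need not be open: a function is smooth on [I] when it is
   infinitely differentiable on a neighborhood of [I]. For an open [I] this is
   infinite differentiability at every point of [I]. *)
Definition smooth_on (V : normedModType R) (I : interval R) (h : R -> V) :
    Prop :=
  forall x, x \in I -> \forall y \near x, forall n, derivable (derive1n n h) y 1.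

Definition meridian_surface (f g : R -> R) (l : R -> 'rV[R]_4) :
    R -> R -> 'rV[R]_4 :=
  fun u v => f u *: l v + g u *: frame R 0.

(* The data of a timelike second kind meridian surface of hyperbolic type. *)
Record timelike_meridian_II_hyperbolic (I J : interval R) (f g : R -> R)
    (l : R -> 'rV[R]_4) : Prop := {
  meridian_nondegenerate_I : nondegenerate I;
  meridian_nondegenerate_J : nondegenerate J;
  meridian_smooth_f : smooth_on I f;
  meridian_smooth_g : smooth_on I g;
  meridian_f_gt0 : forall u, u \in I -> 0 < f u;
  meridian_normalized : forall u, u \in I -> derive1 f u ^+ 2 - derive1 g u ^+ 2 = 1;
  meridian_smooth_l : smooth_on J l;
  meridian_l_hyperbolic : forall v, v \in J -> hyperbolic_plane (l v);
  meridian_l_unit : forall v, v \in J -> mdot (derive1 l v) (derive1 l v) = 1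
}.

End Meridian.

(* Main.v *)
Require Import Defs.
From mathcomp Require Import all_boot all_order all_algebra.
From mathcomp Require Import all_classical all_reals all_analysis.
From mathcomp Require Import ring lra.
Import Order.TTheory GRing.Theory Num.Theory.
Import numFieldNormedType.Exports.
Local Open Scope classical_set_scope.
Local Open Scope ring_scope.

(** The vectors [l], [l'] and [e_1] are pairwise orthogonal, of squares [-1], [1]
    and [1], and [e_1] is also orthogonal to [l'']; moreover
    [z_u = f' l + g' e_1] has square [-1].  So the coordinate frame
    [z_u], [z_v = f l'] is orthogonal, and:
    - differentiating [f'^2 - g'^2 = 1] gives [f' f'' = g' g''], so
      [z_uu = f'' l + g'' e_1] is already normal to the surface;
    - [z_uv = f' l'] is proportional to [z_v], hence has no normal part;
    - [z_vv = f l''] pairs with the normal vector [z_uu] in the same way as its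
      own normal part does, and [<l, l''> = - <l', l'> = -1], so
      [<sigma_uu, sigma_vv> = - f f''].
    As the determinant of the metric is [- f^2], the curvature is
    [K = f'' / f] ([gauss_curvature_meridian]), and flatness means [f'' = 0].

    If [f'' = 0] then [f' = a] is constant and [g'^2 = a^2 - 1].  The sign of
    [g'] cannot change, because [g' g'' = f' f'' = 0]: where [g'] is nonzero
    [g''] vanishes, and if [g'] vanishes anywhere it vanishes everywhere.  So
    [g'] is a constant square root of [a^2 - 1].

    The intervals may contain their endpoints, whereas the constraints on
    [f], [g] and [l] hold on the intervals alone.  Differentiating these
    constraints up to the endpoints rests on [derive_const_on], which only
    looks at difference quotients between points of the interval. *)

(** * The Minkowski product *)

Section MinkowskiProduct.
Context {R : realType}.
Implicit Types X Y Z : 'rV[R]_4.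

Lemma mdotE X Y :
  mdot X Y = X 0 0 * Y 0 0 + X 0 1 * Y 0 1 + X 0 2 * Y 0 2 - X 0 3 * Y 0 3.
Proof.
rewrite /mdot /minkowski_mx mxE !big_ord_recr big_ord0 /=.
rewrite !mul_mx_diag !mxE /=.
have -> : widen_ord (leqnSn 3) (widen_ord (leqnSn 2)
    (widen_ord (leqnSn 1) ord_max)) = 0 :> 'I_4 by exact/val_inj.
have -> : widen_ord (leqnSn 3) (widen_ord (leqnSn 2) ord_max) = 1 :> 'I_4.
  exact/val_inj.
have -> : widen_ord (leqnSn 3) ord_max = 2 :> 'I_4 by exact/val_inj.
have -> : ord_max = 3 :> 'I_4 by exact/val_inj.
rewrite /=; ring.
Qed.

Lemma mdotC X Y : mdot X Y = mdot Y X.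
Proof. by rewrite !mdotE; ring. Qed.

Lemma mdotDl X Y Z : mdot (X + Y) Z = mdot X Z + mdot Y Z.
Proof. by rewrite !mdotE !mxE; ring. Qed.

Lemma mdotZl a X Y : mdot (a *: X) Y = a * mdot X Y.
Proof. by rewrite !mdotE !mxE; ring. Qed.

Lemma mdotDr X Y Z : mdot X (Y + Z) = mdot X Y + mdot X Z.
Proof. by rewrite mdotC mdotDl !(mdotC X). Qed.

Lemma mdotZr a X Y : mdot X (a *: Y) = a * mdot X Y.
Proof. by rewrite mdotC mdotZl mdotC. Qed.

Lemma mdot_frame0l X : mdot (frame R 0) X = X 0 0.
Proof. by rewrite mdotE !mxE /=; ring. Qed.

Lemma span_e234_e1 X :
  (X <= frame R 1 + frame R 2 + frame R 3)%MS -> X 0 0 = 0.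
Proof.
have e1 : (frame R 1 + frame R 2 + frame R 3 <=
           kermx (delta_mx 0 0 : 'cV[R]_4))%MS.
  by rewrite !addsmx_sub !sub_kermx /frame !mul_delta_mx_0 // eqxx.
move=> /submx_trans/(_ e1); rewrite sub_kermx -colE => /eqP/matrixP/(_ 0 0).
by rewrite !mxE.
Qed.

End MinkowskiProduct.

(** * Projection onto the normal plane *)

Section Projection.
Context {R : realType} (z : R -> R -> 'rV[R]_4) (u v : R).
Context {X Y : 'rV[R]_4}.
Context (zuE : partial_u z u v = X) (zvE : partial_v z u v = Y).

Lemma tangent_planeP (Z : 'rV[R]_4) :
  reflect (exists a b, Z = a *: X + b *: Y) (Z <= tangent_plane z u v)%MS.
Proof.
rewrite /tangent_plane zuE zvE.
apply: (iffP sub_addsmxP) => [[[A B] ->]|[a [b ->]]] /=.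
  have /sub_rVP[a ->] : (A *m <<X>> <= X)%MS.
    by rewrite (submx_trans (submxMl _ _))// genmxE.
  have /sub_rVP[b ->] : (B *m <<Y>> <= Y)%MS.
    by rewrite (submx_trans (submxMl _ _))// genmxE.
  by exists a, b.
have /submxP[A ->] : (a *: X <= <<X>>)%MS by rewrite genmxE scalemx_sub.
have /submxP[B ->] : (b *: Y <= <<Y>>)%MS by rewrite genmxE scalemx_sub.
by exists (A, B).
Qed.

(** Transposing the defining equation of the kernel turns it around: the tangent
    plane lies in the kernel of the linear form [<Z, _>], which can be checked
    on the two generators. *)
Lemma normal_planeP (Z : 'rV[R]_4) :
  reflect (mdot Z X = 0 /\ mdot Z Y = 0) (Z <= normal_plane z u v)%MS.
Proof.
have orthE T : (T <= kermx (Z *m minkowski_mx R)^T)%MS = (mdot Z T == 0).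
  rewrite sub_kermx -(inj_eq trmx_inj) trmx_mul trmxK trmx0 /mdot.
  apply/eqP/eqP => [->|ZT]; first by rewrite mxE.
  by apply/rowP => i; rewrite ord1 ZT mxE.
have -> : (Z <= normal_plane z u v)%MS =
    (tangent_plane z u v <= kermx (Z *m minkowski_mx R)^T)%MS.
  by rewrite !sub_kermx mulmxA -(inj_eq trmx_inj) trmx_mul trmxK trmx0.
rewrite /tangent_plane zuE zvE addsmx_sub !genmxE !orthE.
by apply: (iffP andP) => -[/eqP ZX /eqP ZY]; split.
Qed.

(** Gram-Schmidt: when the coordinate frame is orthogonal and non-isotropic, no
    nonzero tangent vector is normal, so the abstract projection is determined
    by any splitting of [W] into a normal and a tangent vector. *)
Lemma normal_part_orthogonal (W : 'rV[R]_4) :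
  mdot X X != 0 -> mdot Y Y != 0 -> mdot X Y = 0 ->
  normal_part z u v W =
    W - ((mdot W X / mdot X X) *: X + (mdot W Y / mdot Y Y) *: Y).
Proof.
move=> X0 Y0 XY0; rewrite /normal_part.
have YX0 : mdot Y X = 0 by rewrite mdotC.
have direct : (normal_plane z u v :&: tangent_plane z u v = 0)%MS.
  apply/eqP/rowV0P => Z; rewrite sub_capmx.
  move=> /andP[ZN /tangent_planeP[a [b Zab]]].
  move/normal_planeP: ZN; rewrite Zab !(mdotDl, mdotZl) XY0 YX0.
  rewrite !mulr0 addr0 add0r.
  move=> [/eqP + /eqP]; rewrite !mulf_eq0 (negbTE X0) (negbTE Y0) !orbF.
  by move=> /eqP-> /eqP->; rewrite !scale0r addr0.
set t := _ *: X + _; set n := W - t.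
have tT : (t <= tangent_plane z u v)%MS.
  by apply/tangent_planeP; exists (mdot W X / mdot X X), (mdot W Y / mdot Y Y).
have nN : (n <= normal_plane z u v)%MS.
  have nE : n = W + (-1) *: t by rewrite scaleN1r.
  apply/normal_planeP; rewrite nE /t !(mdotDl, mdotZl) XY0 YX0.
  rewrite !mulr0 addr0 add0r.
  by rewrite !divfK// !mulN1r !subrr.
rewrite -{1}(subrK t W) -/n mulmxDl.
by rewrite proj_mx_id// proj_mx_0// addr0.
Qed.

End Projection.

(** * Curvature at one point *)

(** The pointwise algebra behind [K = f'' / f], with the derivatives of [f], [g]
    and [l] at the point replaced by arbitrary scalars and vectors subject to
    the relations that differentiation of the constraints produces. *)
Lemma gauss_curvature_of_2jet (R : realType) (z : R -> R -> 'rV[R]_4) (u v : R)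
    (e l l' l'' : 'rV[R]_4) (f f' f'' g' g'' : R) :
  mdot e e = 1 -> mdot e l = 0 -> mdot e l' = 0 -> mdot e l'' = 0 ->
  mdot l l = -1 -> mdot l l' = 0 -> mdot l' l' = 1 -> mdot l l'' = -1 ->
  f != 0 -> f' ^+ 2 - g' ^+ 2 = 1 -> f' * f'' = g' * g'' ->
  partial_u z u v = f' *: l + g' *: e ->
  partial_v z u v = f *: l' ->
  partial_u (partial_u z) u v = f'' *: l + g'' *: e ->
  partial_u (partial_v z) u v = f' *: l' ->
  partial_v (partial_v z) u v = f *: l'' ->
  gauss_curvature z u v = f'' / f.
Proof.
move=> ee el el' el'' ll ll' l'l' ll'' f0 unit accel zu zv zuu zuv zvv.
have le : mdot l e = 0 by rewrite mdotC.
have l'e : mdot l' e = 0 by rewrite mdotC.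
have l'l : mdot l' l = 0 by rewrite mdotC.
have prod := (@mdotDl R, @mdotDr R, @mdotZl R, @mdotZr R,
  ee, el, el', el'', ll, ll', l'l', ll'', le, l'e, l'l,
  @mulr0 R, @addr0 R, @add0r R, @mulr1 R).
have EE : mdot (f' *: l + g' *: e) (f' *: l + g' *: e) = -1.
  by rewrite !prod; lra.
have FF : mdot (f' *: l + g' *: e) (f *: l') = 0 by rewrite !prod.
have GG : mdot (f *: l') (f *: l') = f ^+ 2 by rewrite !prod.
have normalE W : normal_part z u v W =
    W - ((mdot W (f' *: l + g' *: e) / -1) *: (f' *: l + g' *: e)
        + (mdot W (f *: l') / f ^+ 2) *: (f *: l')).
  rewrite -EE -GG; apply: normal_part_orthogonal => //.
    by rewrite EE oppr_eq0 oner_eq0.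
  by rewrite GG expf_neq0.
have uuu : mdot (f'' *: l + g'' *: e) (f' *: l + g' *: e) = 0.
  by rewrite !prod; lra.
have uuv : mdot (f'' *: l + g'' *: e) (f *: l') = 0 by rewrite !prod.
(* So the tangent correction in [sigma_vv] is invisible to [sigma_uu]. *)
have perp a b :
    mdot (f'' *: l + g'' *: e) (a *: (f' *: l + g' *: e) + b *: (f *: l')) = 0.
  by rewrite mdotDr (mdotZr a) (mdotZr b) uuu uuv !mulr0 addr0.
have uuE : sigma_uu z u v = f'' *: l + g'' *: e.
  by rewrite /sigma_uu normalE zuu uuu uuv !mul0r !scale0r addr0 subr0.
have uvE : sigma_uv z u v = 0.
  rewrite /sigma_uv normalE zuv !prod mul0r scale0r add0r scalerA.
  by apply/eqP; rewrite subr_eq0; apply/eqP; congr (_ *: _); field.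
have uuvv : mdot (sigma_uu z u v) (sigma_vv z u v) = - f * f''.
  rewrite uuE /sigma_vv normalE zvv -scaleN1r mdotDr (mdotZr (-1)) perp.
  by rewrite !prod; ring.
have m00 : mdot (0 : 'rV[R]_4) 0 = 0 by rewrite mdotE !mxE; ring.
have -> : gauss_curvature z u v =
    (- f * f'' - 0) / (-1 * f ^+ 2 - 0 ^+ 2).
  rewrite /gauss_curvature.
  congr ((_ - _) / (_ * _ - _ ^+ 2)).
  - exact: uuvv.
  - by rewrite uvE.
  - by rewrite zu.
  - by rewrite zv.
  - by rewrite zu zv.
by field.
Qed.

(** * One-variable calculus on intervals *)

Section Calculus.
Context {R : realType}.

Lemma is_derive_rowP n (M : R -> 'rV[R]_n) (x : R) (dM : 'rV[R]_n) :
  is_derive x 1 M dM <-> forall j, is_derive x 1 (fun t => M t 0 j) (dM 0 j).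
Proof.
split=> [[Mx <-] j|Mx].
  split; first by move/derivable_mxP: Mx; exact.
  by rewrite derive_mx// mxE.
have dx : derivable M x 1.
  by apply/derivable_mxP => i j; rewrite ord1; case: (Mx j).
split=> //; rewrite derive_mx//; apply/rowP => j.
by rewrite mxE; case: (Mx j).
Qed.

Lemma is_derive_mdot {A B : R -> 'rV[R]_4} {x : R} {dA dB : 'rV[R]_4} :
  is_derive x 1 A dA -> is_derive x 1 B dB ->
  is_derive x 1 (fun t => mdot (A t) (B t)) (mdot dA (B x) + mdot (A x) dB).
Proof.
move=> /is_derive_rowP Ax /is_derive_rowP Bx.
under eq_fun do rewrite mdotE.
apply: is_derive_eq; rewrite !mdotE /GRing.scale/=; ring.
Qed.

Lemma is_derive_sqrB {p q : R -> R} {x dp dq : R} :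
  is_derive x 1 p dp -> is_derive x 1 q dq ->
  is_derive x 1 (fun t => p t ^+ 2 - q t ^+ 2) (2 * (p x * dp - q x * dq)).
Proof.
by move=> px qx; apply: is_derive_eq; rewrite /GRing.scale/=; ring.
Qed.

Lemma is_derive_scalel n (h : R -> R) (c : 'rV[R]_n) (x : R) (dh : R) :
  is_derive x 1 h dh -> is_derive x 1 (fun t => h t *: c) (dh *: c).
Proof.
move=> hx; apply/is_derive_rowP => j.
under eq_fun do rewrite mxE mulrC.
by apply: is_derive_eq; rewrite mxE mulrC.
Qed.

Lemma is_derive1E {V : normedModType R} {h : R -> V} {x : R} {dh : V} :
  is_derive x 1 h dh -> derive1 h x = dh.
Proof. by move=> hx; rewrite derive1E derive_val. Qed.

Lemma itv_between {I : interval R} {x y t} :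
  x \in I -> y \in I -> x <= t <= y -> t \in I.
Proof.
by move=> xI yI xty; exact: (@interval_is_interval _ I x y xI yI t xty).
Qed.

(** At an endpoint [h] is constant on one side of [x] only, so [h] need not agree
    with a constant function near [x].  But if [dh] were nonzero, all difference
    quotients at small steps would be nonzero, including those towards another
    point [y] of the interval. *)
Lemma derive_const_on {V : normedModType R} {I : interval R} {h : R -> V}
    {c dh : V} {x : R} :
  Defs.nondegenerate I -> x \in I -> is_derive x 1 h dh ->
  (forall y, y \in I -> h y = c) -> dh = 0.
Proof.
move=> [a [b [aI bI ab]]] xI [hx <-] hc.
have [y yI yx] : exists2 y, y \in I & y - x != 0.
  have [xb|xb] := eqVneq x b.
    by exists a => //; rewrite subr_eq0 xb lt_eqF.
  by exists b => //; rewrite subr_eq0 eq_sym.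
have conv t : 0 <= t <= 1 -> x + t * (y - x) \in I.
  move=> /andP[t0 t1]; have [xy|xy] := leP x y.
    by apply: (itv_between xI yI); apply/andP; split; nra.
  by apply: (itv_between yI xI); apply/andP; split; nra.
apply/eqP/negPn/negP => dh0.
have := cvgr_neq0 _ hx; rewrite -[lim _]/(derive h x 1) => /(_ _ dh0).
move=> /nbhs_ballP[e /= e0 He].
(* A step towards [y] that stays in [I] and in the ball of radius [e]. *)
pose s := Num.min 1 (e / 2 / `|y - x|).
have s0 : 0 < s by rewrite lt_min ltr01 !divr_gt0// normr_gt0.
have sy0 : s * (y - x) != 0 by rewrite mulf_neq0// gt_eqF.
have sye : ball 0 e (s * (y - x)).
  rewrite /ball/= sub0r normrN normrM (gtr0_norm s0).
  apply: (@le_lt_trans _ _ (e / 2)); last by lra.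
  by rewrite -ler_pdivlMr ?normr_gt0// ge_min lexx orbT.
have /negP[] := He _ sye sy0; apply/eqP.
rewrite /= [_ *: 1]mulr1 !hc ?subrr ?scaler0// addrC conv//.
by rewrite ltW//= ge_min lexx.
Qed.

Lemma mdot_const_on {I : interval R} {A B : R -> 'rV[R]_4} {x : R}
    {dA dB : 'rV[R]_4} {c : R} :
  Defs.nondegenerate I -> x \in I ->
  is_derive x 1 A dA -> is_derive x 1 B dB ->
  (forall t, t \in I -> mdot (A t) (B t) = c) ->
  mdot dA (B x) + mdot (A x) dB = 0.
Proof.
move=> ndI xI Ax Bx AB.
exact: derive_const_on ndI xI (is_derive_mdot Ax Bx) AB.
Qed.

Lemma const_on_derive0 {I : interval R} {h : R -> R} :
  (forall x, x \in I -> is_derive x 1 h 0) ->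
  forall x y, x \in I -> y \in I -> h x = h y.
Proof.
move=> h0; suff main x y : x \in I -> y \in I -> x <= y -> h x = h y.
  move=> x y xI yI; have [xy|/ltW yx] := leP x y; first exact: main.
  by apply/esym/main.
move=> xI yI xy.
have hD t : t \in `[x, y]%R -> is_derive t 1 h 0.
  by rewrite in_itv/= => txy; apply: h0; exact: itv_between txy.
have dh t : t \in `]x, y[%R -> is_derive t 1 h ((fun=> 0) t).
  by move=> txy; apply: hD; exact: subset_itv_oo_cc.
have ch : {within `[x, y], continuous h}.
  by apply: derivable_within_continuous => t /hD[].
have [c _] := MVT_segment xy dh ch.
by rewrite mul0r => /subr0_eq.
Qed.

Lemma affine_on_derive {I : interval R} {h dh : R -> R} {a : R} :
  Defs.nondegenerate I -> (forall x, x \in I -> is_derive x 1 h (dh x)) ->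
  (forall x, x \in I -> dh x = a) ->
  exists b, forall x, x \in I -> h x = a * x + b.
Proof.
move=> [x0 [_ [x0I _ _]]] hI dhI; exists (h x0 - a * x0) => x xI.
have ha t : t \in I -> is_derive t 1 (fun t => h t - a * t) 0.
  move=> tI; have ht := hI t tI; apply: is_derive_eq.
  by rewrite dhI// /GRing.scale/= mulr1 subrr.
by rewrite -(const_on_derive0 ha _ _ xI x0I); ring.
Qed.

Lemma smooth_on_is_derive {V : normedModType R} {K : interval R} {h : R -> V}
    {x : R} (n : nat) :
  smooth_on K h -> x \in K ->
  \forall y \near x, is_derive (y : R) 1 (derive1n n h) (derive1n n.+1 h y).
Proof.
move=> hK /hK; apply: filterS => y /(_ n) hy.
by split=> //; rewrite derive1nS derive1E.
Qed.

End Calculus.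

(** * Meridian surfaces *)

Section Curvature.
Context {R : realType} {I J : interval R} {f g : R -> R} {l : R -> 'rV[R]_4}.
Context (hM : timelike_meridian_II_hyperbolic I J f g l).

Let z := meridian_surface f g l.

Lemma meridian_partial_u u v : u \in I ->
  \forall t \near u,
    partial_u z t v = derive1 f t *: l v + derive1 g t *: frame R 0.
Proof.
move=> uI.
have fu := smooth_on_is_derive 0 (meridian_smooth_f hM) uI.
have gu := smooth_on_is_derive 0 (meridian_smooth_g hM) uI.
near=> t; apply: is_derive1E; apply: is_deriveD; apply: is_derive_scalel.
  by near: t.
by near: t.
Unshelve. all: by end_near. Qed.

Lemma meridian_partial_v u v : v \in J ->
  \forall t \near v, partial_v z u t = f u *: derive1 l t.
Proof.
move=> /(smooth_on_is_derive 0 (meridian_smooth_l hM)).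
apply: filterS => t lt; apply: is_derive1E.
by apply: is_derive_eq; rewrite addr0.
Qed.

Lemma meridian_partial_uu u v : u \in I ->
  partial_u (partial_u z) u v =
  derive1n 2 f u *: l v + derive1n 2 g u *: frame R 0.
Proof.
move=> uI.
have fu := nbhs_singleton (smooth_on_is_derive 1 (meridian_smooth_f hM) uI).
have gu := nbhs_singleton (smooth_on_is_derive 1 (meridian_smooth_g hM) uI).
apply: is_derive1E; apply: near_eq_is_derive.
  by near do apply/esym; exact: meridian_partial_u.
by apply: is_deriveD; apply: is_derive_scalel.
Unshelve. all: by end_near. Qed.

Lemma meridian_partial_uv u v : u \in I -> v \in J ->
  partial_u (partial_v z) u v = derive1 f u *: derive1 l v.
Proof.
move=> uI vJ.
have fu := nbhs_singleton (smooth_on_is_derive 0 (meridian_smooth_f hM) uI).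
apply: is_derive1E.
under eq_fun do rewrite (nbhs_singleton (meridian_partial_v _ _ vJ)).
exact: is_derive_scalel.
Qed.

Lemma meridian_partial_vv u v : v \in J ->
  partial_v (partial_v z) u v = f u *: derive1n 2 l v.
Proof.
move=> vJ.
have lv := nbhs_singleton (smooth_on_is_derive 1 (meridian_smooth_l hM) vJ).
apply: is_derive1E; apply: near_eq_is_derive.
  by near do apply/esym; exact: meridian_partial_v.
Unshelve. all: by end_near. Qed.

(** The derivative of the arc-length normalization: the acceleration of the
    meridian is orthogonal to its velocity. *)
Lemma meridian_acceleration {u} : u \in I ->
  derive1 f u * derive1n 2 f u = derive1 g u * derive1n 2 g u.
Proof.
move=> uI.
have fu := nbhs_singleton (smooth_on_is_derive 1 (meridian_smooth_f hM) uI).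
have gu := nbhs_singleton (smooth_on_is_derive 1 (meridian_smooth_g hM) uI).
pose F t := derive1 f t ^+ 2 - derive1 g t ^+ 2.
have dF : is_derive u 1 F
    (2 * (derive1 f u * derive1n 2 f u - derive1 g u * derive1n 2 g u)).
  exact: is_derive_sqrB.
have /eqP := derive_const_on (meridian_nondegenerate_I hM) uI dF
  (meridian_normalized hM).
by rewrite mulf_eq0 pnatr_eq0/= subr_eq0 => /eqP.
Qed.

(** Differentiating [<l, l> = -1] gives [<l, l'> = 0], and differentiating again
    gives [<l', l'> + <l, l''> = 0]. *)
Lemma hyperbolic_curve_products {v} : v \in J ->
  [/\ mdot (l v) (l v) = -1, mdot (l v) (derive1 l v) = 0,
      mdot (derive1 l v) (derive1 l v) = 1 & mdot (l v) (derive1n 2 l v) = -1].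
Proof.
have ndJ := meridian_nondegenerate_J hM.
have l0 t : t \in J -> is_derive t 1 l (derive1 l t).
  by move=> /(smooth_on_is_derive 0 (meridian_smooth_l hM))/nbhs_singleton.
have l1 t : t \in J -> is_derive t 1 (derive1 l) (derive1n 2 l t).
  by move=> /(smooth_on_is_derive 1 (meridian_smooth_l hM))/nbhs_singleton.
have ll t : t \in J -> mdot (l t) (l t) = -1.
  by move=> /(meridian_l_hyperbolic hM)[].
have ll' t : t \in J -> mdot (l t) (derive1 l t) = 0.
  move=> tJ; have := mdot_const_on ndJ tJ (l0 t tJ) (l0 t tJ) ll.
  by rewrite mdotC; lra.
move=> vJ; have l'l' := meridian_l_unit hM vJ.
split; [exact: ll|exact: ll'|by []|].
have := mdot_const_on ndJ vJ (l0 v vJ) (l1 v vJ) ll'; rewrite l'l' => /eqP.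
by rewrite addrC addr_eq0 => /eqP.
Qed.

Lemma hyperbolic_curve_e1 {v} : v \in J ->
  [/\ l v 0 0 = 0, derive1 l v 0 0 = 0 & derive1n 2 l v 0 0 = 0].
Proof.
have ndJ := meridian_nondegenerate_J hM.
have l0 t : t \in J -> is_derive t 1 (fun x => l x 0 0) (derive1 l t 0 0).
  move=> /(smooth_on_is_derive 0 (meridian_smooth_l hM))/nbhs_singleton.
  by move=> /is_derive_rowP/(_ 0).
have l1 t : t \in J ->
    is_derive t 1 (fun x => derive1 l x 0 0) (derive1n 2 l t 0 0).
  move=> /(smooth_on_is_derive 1 (meridian_smooth_l hM))/nbhs_singleton.
  by move=> /is_derive_rowP/(_ 0).
have e0 t : t \in J -> l t 0 0 = 0.
  by move=> /(meridian_l_hyperbolic hM)[/span_e234_e1].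
have e1 t : t \in J -> derive1 l t 0 0 = 0.
  by move=> tJ; exact: derive_const_on ndJ tJ (l0 t tJ) e0.
move=> vJ; split; [exact: e0|exact: e1|].
exact: derive_const_on ndJ vJ (l1 v vJ) e1.
Qed.

Lemma gauss_curvature_meridian u v : u \in I -> v \in J ->
  gauss_curvature z u v = derive1n 2 f u / f u.
Proof.
move=> uI vJ.
have [ll ll' l'l' ll''] := hyperbolic_curve_products vJ.
have [l0 l'0 l''0] := hyperbolic_curve_e1 vJ.
apply: (@gauss_curvature_of_2jet _ z u v (frame R 0) (l v) (derive1 l v)
  (derive1n 2 l v) (f u) (derive1 f u) (derive1n 2 f u) (derive1 g u)
  (derive1n 2 g u)).
- by rewrite mdot_frame0l mxE.
- by rewrite mdot_frame0l.
- by rewrite mdot_frame0l.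
- by rewrite mdot_frame0l.
- exact: ll.
- exact: ll'.
- exact: l'l'.
- exact: ll''.
- by rewrite gt_eqF// (meridian_f_gt0 hM).
- exact: meridian_normalized hM _ uI.
- exact: meridian_acceleration.
- exact: nbhs_singleton (meridian_partial_u u v uI).
- exact: nbhs_singleton (meridian_partial_v u v vJ).
- exact: meridian_partial_uu.
- exact: meridian_partial_uv.
- exact: meridian_partial_vv.
Qed.

End Curvature.

Theorem theorem5p2 (R : realType) (I J : interval R) (f g : R -> R)
    (l : R -> 'rV[R]_4) (hM : timelike_meridian_II_hyperbolic I J f g l) :
  flat_on I J (meridian_surface f g l) <->
  exists a b c : R,
    [/\ 1 <= a ^+ 2,
        (forall u, u \in I -> f u = a * u + b)
      & (forall u, u \in I -> g u = Num.sqrt (a ^+ 2 - 1) * u + c) \/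
        (forall u, u \in I -> g u = - Num.sqrt (a ^+ 2 - 1) * u + c)].
Proof.
have ndI := meridian_nondegenerate_I hM.
have [v0 [_ [v0J _ _]]] := meridian_nondegenerate_J hM.
have [u0 [_ [u0I _ _]]] := ndI.
have f0 t : t \in I -> is_derive t 1 f (derive1 f t).
  by move=> /(smooth_on_is_derive 0 (meridian_smooth_f hM))/nbhs_singleton.
have f1 t : t \in I -> is_derive t 1 (derive1 f) (derive1n 2 f t).
  by move=> /(smooth_on_is_derive 1 (meridian_smooth_f hM))/nbhs_singleton.
have g0 t : t \in I -> is_derive t 1 g (derive1 g t).
  by move=> /(smooth_on_is_derive 0 (meridian_smooth_g hM))/nbhs_singleton.
have g1 t : t \in I -> is_derive t 1 (derive1 g) (derive1n 2 g t).
  by move=> /(smooth_on_is_derive 1 (meridian_smooth_g hM))/nbhs_singleton.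
split=> [flat|[a [b [c [_ fE _]]]]]; last first.
  have f'E u : u \in I -> derive1 f u = a.
    move=> uI; have fu := f0 u uI.
    have d : is_derive u 1 (fun t => f t - a * t) (derive1 f u - a).
      by apply: is_derive_eq; rewrite /GRing.scale/= mulr1.
    apply: subr0_eq.
    apply: (derive_const_on (h := fun t => f t - a * t) (c := b) ndI uI d).
    by move=> t /fE->; ring.
  move=> u v uI vJ; rewrite (gauss_curvature_meridian hM)//.
  by rewrite (derive_const_on ndI uI (f1 u uI) f'E) mul0r.
have f''0 u : u \in I -> derive1n 2 f u = 0.
  move=> uI; have := flat _ _ uI v0J; rewrite (gauss_curvature_meridian hM)//.
  move/eqP; rewrite mulf_eq0 invr_eq0 [f u == 0]gt_eqF ?(meridian_f_gt0 hM)//.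
  by rewrite orbF => /eqP.
pose a := derive1 f u0; pose d := derive1 g u0.
have f'E u : u \in I -> derive1 f u = a.
  move=> uI; apply: (@const_on_derive0 _ I _ _ _ _ uI u0I) => t tI.
  by rewrite -(f''0 t tI); exact: f1.
have ad u : u \in I -> derive1 g u ^+ 2 = a ^+ 2 - 1.
  by move=> uI; have := meridian_normalized hM uI; rewrite f'E//; lra.
have g'E u : u \in I -> derive1 g u = d.
  move=> uI; apply: (@const_on_derive0 _ I _ _ _ _ uI u0I) => t tI.
  suff <- : derive1n 2 g t = 0 by exact: g1.
  have [g'0|g'0] := eqVneq (derive1 g t) 0.
    (* One zero of [g'] forces [a ^+ 2 = 1], so [g'] is zero on all of [I]. *)
    have a1 : a ^+ 2 - 1 = 0 by rewrite -(ad t tI) g'0 expr0n.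
    apply: (derive_const_on (c := 0) ndI tI (g1 t tI)).
    by move=> y yI; apply/eqP; rewrite -sqrf_eq0 ad// a1.
  have := meridian_acceleration hM tI; rewrite f''0// mulr0 => /esym/eqP.
  by rewrite mulf_eq0 (negbTE g'0) => /eqP.
have [b fE] := affine_on_derive ndI f0 f'E.
have [c gE] := affine_on_derive ndI g0 g'E.
have d2 := ad u0 u0I; rewrite -/d in d2.
exists a, b, c; split=> //; first by rewrite -subr_ge0 -d2 sqr_ge0.
rewrite -d2 sqrtr_sqr; have [d0|d0] := leP 0 d.
  by left; rewrite ger0_norm.
by right; rewrite ltr0_norm// opprK.
Qed.
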